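(* On the complex conic $\gamma=\{w=z^2\}$ the dual billiards of types 2b1) and 2b2) are complex-projectively equivalent, and so are the dual billiards of types 2c1) and 2c2). For every $g\in\{b,c\}$ there exists a complex projective equivalence between the billiards 2g1) and 2g2) that sends the integral $R_{g1}$ of the former (treated as a rational function on $\mathbb{CP}^2_{[z:w:t]}\supset\mathbb C^2_{z,w}=\{t=1\}$) to the integral $R_{g2}$ of the latter, up to constant factor, where $$R_{b1}=\frac{(w-z^2)^2}{(w+3z^2)(z-1)(z-w)},\qquad R_{b2}=\frac{(w-z^2)^2}{(z^2+w^2+w+1)(z^2+1)},$$ $$R_{c1}=\frac{(w-z^2)^3}{(1+w^3-2zw)^2},\qquad R_{c2}=\frac{(w-z^2)^3}{(8z^3-8z^2w-8z^2-w^2-w+10zw)^2}.$$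
   Context: For $P\in\gamma$, $L_P$ is the complex projective tangent line to $\gamma$ at $P$. A complex dual billiard structure on a (punctured) curve $\gamma\subset\mathbb{CP}^2$ is a family of non-trivial complex projective involutions $\sigma_P:L_P\to L_P$ fixing $P$; a rational integral is a non-constant rational function $R$ on $\mathbb{CP}^2$ with $R\circ\sigma_P=R$ on $L_P$ for all $P$. Two such structures are complex-projectively equivalent if a complex projective transformation of $\mathbb{CP}^2$ sends one curve to the other and one structure to the other. The types in question are dual billiards on the conic $\gamma=\{w=z^2\}$ (punctured at finitely many points): for $P=(z_0,z_0^2)\in\gamma$, in the coordinate $u=z-z_0$ on $L_P$, $\sigma_P:u\mapsto-\frac{u}{1+f(z_0)u}$, where type 2b1): $f(z)=\frac{5z-3}{2z(z-1)}$; type 2b2): $f(z)=\frac{3z}{z^2+1}$; type 2c1): $f(z)=\frac{4z^2}{z^3-1}$; type 2c2): $f(z)=\frac{8z-4}{3z(z-1)}$. They have the integrals $R_{b1},R_{b2},R_{c1},R_{c2}$ respectively. *)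

(* Defs.v *)
From HB Require Import structures.
From mathcomp Require Import all_boot all_order all_algebra.
From mathcomp Require Import fraction.
From mathcomp Require Import mpoly ring.

Set Implicit Arguments.
Unset Strict Implicit.
Unset Printing Implicit Defensive.

Import Order.TTheory GRing.Theory Num.Theory.
Local Open Scope ring_scope.

(* Indices of the homogeneous coordinates [z : w : t]; the affine plane
   C^2_{z,w} is {t = 1}. *)
Definition iz : 'I_3 := @Ordinal 3 0 isT.
Definition iw : 'I_3 := @Ordinal 3 1 isT.
Definition it : 'I_3 := @Ordinal 3 2 isT.

Definition hvec (C : nzRingType) (a b c : C) : 'rV[C]_3 :=
  \row_(j < 3) [:: a; b; c]`_j.

Section Plane.
Variable C : fieldType.

Definition CP2 : Type := {V : {vspace 'rV[C]_3} | \dim V == 1%N}.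

Fact dim_origin : \dim <[hvec 0 0 1 : 'rV[C]_3]> == 1%N.
Proof.
rewrite dim_vline eqb1; apply/eqP => /(congr1 (fun v : 'rV__ => v 0 it)).
by rewrite !mxE /= => /eqP; rewrite oner_eq0.
Qed.

Definition origin : CP2 :=
  exist (fun V : {vspace _} => \dim V == 1%N) _ dim_origin.

(* The point with homogeneous coordinates v (a junk value if v = 0). *)
Definition mkpt (v : 'rV[C]_3) : CP2 := insubd origin <[v]>%VS.

(* A choice of homogeneous coordinates of P. *)
Definition hcoord (P : CP2) : 'rV[C]_3 := vpick (val P).

Definition heval (p : {mpoly C[3]}) (P : CP2) : C := p.@[fun i => hcoord P 0 i].

(* The projective transformation induced by an invertible matrix A, acting on
   row vectors of homogeneous coordinates. *)
Definition proj (A : 'M[C]_3) (P : CP2) : CP2 := mkpt (hcoord P *m A).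

(* Q lies on the projective tangent line at P to the curve {F = 0}. *)
Definition tangent (F : {mpoly C[3]}) (P Q : CP2) : Prop :=
  \sum_(i < 3) heval (F^`M(i)) P * hcoord Q 0 i = 0.

(* s restricts to a non-trivial projective involution of the line L; every
   projective map of a line is induced by a projective map of the plane. *)
Definition proj_involution (L : CP2 -> Prop) (s : CP2 -> CP2) : Prop :=
  [/\ exists2 M : 'M[C]_3, M \in unitmx & forall Q, L Q -> s Q = proj M Q,
      forall Q, L Q -> L (s Q),
      forall Q, L Q -> s (s Q) = Q
    & exists2 Q, L Q & s Q != Q].

Lemma hcoord_neq0 P : hcoord P != 0.
Proof. by rewrite vpick0 -dimv_eq0 (eqP (valP P)). Qed.

Lemma val_mkpt v : v != 0 -> val (mkpt v) = <[v]>%VS.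
Proof. by move=> v0; rewrite insubdK // unfold_in dim_vline v0. Qed.

Lemma hcoordK P : mkpt (hcoord P) = P.
Proof.
apply: val_inj; rewrite val_mkpt ?hcoord_neq0 //; apply/eqP.
rewrite eqEdim -memvE memv_pick dim_vline hcoord_neq0.
by rewrite (eqP (valP P)).
Qed.

Lemma hcoord_mkpt v : v != 0 -> exists2 c, c != 0 & hcoord (mkpt v) = c *: v.
Proof.
move=> v0; have := memv_pick (val (mkpt v)); rewrite {2}val_mkpt //.
case/vlineP => c e; exists c => //; apply: contraNneq (hcoord_neq0 (mkpt v)).
by move=> c0; rewrite /hcoord e c0 scale0r.
Qed.

Lemma mkptZ c v : c != 0 -> mkpt (c *: v) = mkpt v.
Proof.
move=> c0; have [->|v0] := eqVneq v 0; first by rewrite scaler0.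
have cv0 : c *: v != 0 by rewrite scaler_eq0 negb_or c0.
apply: val_inj; rewrite !val_mkpt //; apply/eqP.
by rewrite eqEdim -memvE memvZ ?memv_line // !dim_vline v0 cv0.
Qed.

Lemma mkpt_eq v w : v != 0 -> w != 0 -> mkpt v = mkpt w ->
  exists2 c, c != 0 & v = c *: w.
Proof.
move=> v0 w0 e; have [a a0 ea] := hcoord_mkpt v0.
have [b b0 eb] := hcoord_mkpt w0; exists (a^-1 * b); first by rewrite mulf_neq0 ?invr_eq0.
by rewrite -scalerA -eb -e ea scalerA mulVf // scale1r.
Qed.

Lemma proj_involution_mx (L : CP2 -> Prop) (s : CP2 -> CP2)
    (M : 'M[C]_3) (l : 'cV[C]_3) (x0 : 'rV[C]_3) :
    (forall Q, L Q <-> hcoord Q *m l = 0) ->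
    (forall Q, L Q -> s Q = proj M Q) ->
    M *m M = 1%:M ->
    (forall x : 'rV[C]_3, x *m l = 0 -> x *m M *m l = 0) ->
    x0 *m l = 0 -> (forall c, x0 *m M <> c *: x0) ->
  proj_involution L s.
Proof.
move=> HL Hs MM Ml x0l x0M.
have Mu : M \in unitmx by case: (mulmx1_unit MM).
have nz (v : 'rV[C]_3) : v != 0 -> v *m M != 0.
  by apply: contra_neq => e; rewrite -[v]mulmx1 -MM mulmxA e mul0mx.
have Hin Q : L Q -> L (s Q).
  move=> LQ; rewrite Hs // HL /proj.
  have [c c0 ->] := hcoord_mkpt (nz _ (hcoord_neq0 Q)).
  by rewrite -scalemxAl Ml ?scaler0 // -HL.
have x00 : x0 != 0.
  by apply/eqP => e; apply: (x0M 0); rewrite e mul0mx scaler0.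
have [c c0 ec] := hcoord_mkpt x00.
split=> //; first by exists M.
- move=> Q LQ; rewrite Hs; last exact: Hin.
  rewrite Hs // /proj.
  have [d d0 ->] := hcoord_mkpt (nz _ (hcoord_neq0 Q)).
  by rewrite -scalemxAl -mulmxA MM mulmx1 mkptZ // hcoordK.
- have Lx : L (mkpt x0) by rewrite HL ec -scalemxAl x0l scaler0.
  exists (mkpt x0) => //; apply/eqP; rewrite Hs // /proj ec -scalemxAl mkptZ //.
  by case/(mkpt_eq (nz _ x00) x00) => d _ /x0M.
Qed.

Definition punctured_curve (F : {mpoly C[3]}) (punct : seq CP2) (P : CP2) : bool :=
  (heval F P == 0) && (P \notin punct).

(* [db_inv P] is only meaningful for P on the punctured curve, and only on the
   tangent line at P. *)
Record dual_billiard := DualBilliard {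
  db_eqn : {mpoly C[3]};
  db_deg : nat;
  db_punct : seq CP2;
  db_inv : CP2 -> CP2 -> CP2;
  db_homog : db_eqn \is db_deg.-homog;
  db_smooth : forall P, punctured_curve db_eqn db_punct P ->
    exists i, heval (db_eqn^`M(i)) P != 0;
  db_involutive : forall P, punctured_curve db_eqn db_punct P ->
    proj_involution (tangent db_eqn P) (db_inv P);
  db_fix : forall P, punctured_curve db_eqn db_punct P -> db_inv P P = P }.

Definition db_curve (B : dual_billiard) : CP2 -> bool :=
  punctured_curve (db_eqn B) (db_punct B).

Definition db_tangent (B : dual_billiard) : CP2 -> CP2 -> Prop :=
  tangent (db_eqn B).

Definition is_equivalence (A : 'M[C]_3) (B1 B2 : dual_billiard) : Prop :=
  [/\ A \in unitmx,
      forall P, db_curve B1 P = db_curve B2 (proj A P)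
    & forall P Q, db_curve B1 P -> db_tangent B1 P Q ->
        proj A (db_inv B1 P Q) = db_inv B2 (proj A P) (proj A Q)].

Definition equivalent (B1 B2 : dual_billiard) : Prop :=
  exists A, is_equivalence A B1 B2.

(* Rational functions on the plane are the elements of C(z, w, t) which are
   homogeneous of degree 0. *)
Definition field3 := {fraction {mpoly C[3]}}.

Definition is_repr (f : field3) (p q : {mpoly C[3]}) : Prop :=
  [/\ exists2 d, p \is d.-homog & q \is d.-homog, q != 0
    & f = tofrac p / tofrac q].

Definition is_ratfun (f : field3) : Prop := exists p q, is_repr f p q.

(* f is regular at P, with value y. *)
Definition has_value (f : field3) (P : CP2) (y : C) : Prop :=
  exists p q, [/\ is_repr f p q, heval q P != 0 & y = heval p P / heval q P].

Definition cst (c : C) : field3 := tofrac (mpolyC 3 c).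

Definition rational_integral (B : dual_billiard) (f : field3) : Prop :=
  [/\ is_ratfun f, forall c, f <> cst c
    & forall P Q y y', db_curve B P -> db_tangent B P Q ->
        has_value f Q y -> has_value f (db_inv B P Q) y' -> y = y'].

(* Substitution v |-> v *m A in the variables v = (z, w, t). *)
Definition lin_subst (A : 'M[C]_3) (p : {mpoly C[3]}) : {mpoly C[3]} :=
  p \mPo [tuple \sum_(i < 3) A i j *: 'X_i | j < 3].

(* f o proj A, for A invertible. *)
Definition pullback (A : 'M[C]_3) (f : field3) : field3 :=
  tofrac (lin_subst A \n_(repr f)) / tofrac (lin_subst A \d_(repr f)).

(* The image f o (proj A)^-1 of f under proj A. *)
Definition pushforward (A : 'M[C]_3) (f : field3) : field3 :=
  pullback (invmx A) f.

(* The rational function on the plane given by an expression in the affine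
   coordinates z and w. *)
Definition on_plane (e : field3 -> field3 -> field3) : field3 :=
  e (tofrac 'X_iz / tofrac 'X_it) (tofrac 'X_iw / tofrac 'X_it).

End Plane.

Section Conic.
Variable C : numClosedFieldType.
Implicit Types (z f u : C) (x : 'rV[C]_3).

Definition conic : {mpoly C[3]} := 'X_iw * 'X_it - 'X_iz ^+ 2.

Definition conic_pt z : CP2 C := mkpt (hvec z (z ^+ 2) 1).
Definition conic_inf : CP2 C := mkpt (hvec 0 1 0).

(* The tangent line at (z0, z0^2) consists of the points with homogeneous
   coordinates a (z0, z0^2, 1) + b (1, 2 z0, 0), where u = z - z0 = b / a.
   The map u |-> - u / (1 + f u) sends (a, b) to (a + f b, - b). *)
Definition line_vec z0 a b : 'rV[C]_3 :=
  a *: hvec z0 (z0 ^+ 2) 1 + b *: hvec 1 (2 * z0) 0.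

Definition inv_vec z0 f x : 'rV[C]_3 :=
  let a := x 0 it in let b := x 0 iz - z0 * x 0 it in
  line_vec z0 (a + f * b) (- b).

Definition swap_vec x : 'rV[C]_3 := hvec (x 0 iz) (x 0 it) (x 0 iw).

(* The exchange of w and t preserves the conic and acts on it by z |-> s = 1/z.
   It transforms the structure given by a rational function f into the one given
   by g(s) = 4/s - f(1/s)/s^2 (lemma [swap_inv_vec]). For f = [fb1], [fb2] or
   [fc2], g has a pole at s = 0 and the point at infinity is a puncture. For
   f = [fc1], g(s) = 4s^2/(s^3 - 1) (lemma [fc1_swap]), so the structure extends
   holomorphically to the point at infinity, with g(0) = 0. *)
Definition conic_inv (f : C -> C) (P Q : CP2 C) : CP2 C :=
  let v := hcoord P in
  if v 0 it != 0 then
    let z0 := v 0 iz / v 0 it in mkpt (inv_vec z0 (f z0) (hcoord Q))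
  else mkpt (swap_vec (inv_vec 0 0 (swap_vec (hcoord Q)))).

Lemma row3P (x y : 'rV[C]_3) :
  x 0 iz = y 0 iz -> x 0 iw = y 0 iw -> x 0 it = y 0 it -> x = y.
Proof.
move=> h0 h1 h2; apply/rowP => -[[|[|[|//]]] hj].
- by rewrite (_ : Ordinal hj = iz) //; apply: val_inj.
- by rewrite (_ : Ordinal hj = iw) //; apply: val_inj.
- by rewrite (_ : Ordinal hj = it) //; apply: val_inj.
Qed.

Lemma hvecE (a b c : C) : (hvec a b c 0 iz = a) * (hvec a b c 0 iw = b)
  * (hvec a b c 0 it = c).
Proof. by rewrite !mxE. Qed.

Lemma sum3 (V : zmodType) (F : 'I_3 -> V) :
  \sum_i F i = F iz + F iw + F it.
Proof.
rewrite !big_ord_recr big_ord0 /= add0r.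
by congr (F _ + F _ + F _); apply: val_inj.
Qed.

Lemma heval_conic P : heval conic P =
  hcoord P 0 iw * hcoord P 0 it - hcoord P 0 iz ^+ 2.
Proof. by rewrite /heval mevalB expr2 !mevalM !mevalXU. Qed.

Lemma conic_homog : conic \is 2.-homog.
Proof.
apply: rpredB; first by apply: (@dhomogM _ _ _ 1 _ 1); rewrite dhomogX; apply/eqP; exact: mdeg1.
by rewrite expr2; apply: (@dhomogM _ _ _ 1 _ 1); rewrite dhomogX; apply/eqP; exact: mdeg1.
Qed.

Lemma mderivXU (i j : 'I_3) : ('X_j : {mpoly C[3]})^`M(i) = (j == i)%:R.
Proof.
rewrite mderivX mnm1E; case: eqP => [->|_]; last by rewrite scale0r.
rewrite scale1r (_ : (_ - _)%MM = 0%MM) ?mpolyX0 //.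
by apply/mnmP => k; rewrite mnmBE mnm0E subnn.
Qed.

Lemma heval_dconic P :
  (heval (conic^`M(iz)) P = - 2 * hcoord P 0 iz) *
  (heval (conic^`M(iw)) P = hcoord P 0 it) *
  (heval (conic^`M(it)) P = hcoord P 0 iw).
Proof.
rewrite /heval /conic expr2.
rewrite !mderivB !mderivM !mderivXU /= !mul0r !mulr0 !mul1r !mulr1 ?mul0r ?mulr0.
by rewrite !add0r !addr0 !subr0 ?sub0r mevalN mevalD !mevalXU mulNr mulr_natl mulr2n.
Qed.

Lemma tangent_conic P Q : tangent conic P Q <->
  hcoord P 0 it * hcoord Q 0 iw + hcoord P 0 iw * hcoord Q 0 it
    = 2 * hcoord P 0 iz * hcoord Q 0 iz.
Proof.
rewrite /tangent sum3 !heval_dconic; split=> h; apply/eqP.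
  rewrite -subr_eq0 -h; apply/eqP; ring.
rewrite (_ : _ + _ = 0) //; apply/eqP; rewrite -[X in X == _]opprK oppr_eq0.
rewrite -(subrr (2 * hcoord P 0 iz * hcoord Q 0 iz)) -{2}h; apply/eqP; ring.
Qed.

Lemma conic_smooth punct P : punctured_curve conic punct P ->
  exists i, heval (conic^`M(i)) P != 0.
Proof.
case/andP; rewrite heval_conic subr_eq0 => /eqP e _.
have [t0|t0] := eqVneq (hcoord P 0 it) 0; last by exists iw; rewrite heval_dconic.
exists it; rewrite heval_dconic; apply: contra_neq (hcoord_neq0 P) => w0.
apply: row3P; rewrite mxE //; apply/eqP.
by rewrite -sqrf_eq0 -e t0 mulr0.
Qed.

Lemma mulmx_hvecT x (a b c : C) : x *m (hvec a b c)^T = 0 <->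
  a * x 0 iz + b * x 0 iw + c * x 0 it = 0.
Proof.
have -> : x *m (hvec a b c)^T = (a * x 0 iz + b * x 0 iw + c * x 0 it)%:M.
  apply/rowP => j; rewrite ord1 mxE sum3 !mxE /= mulr1n; ring.
split=> [/matrixP/(_ 0 0)|->]; last by rewrite raddf0.
by rewrite !mxE /= mulr1n.
Qed.

Lemma inv_vecE z0 f x :
  let a := x 0 it + f * (x 0 iz - z0 * x 0 it) in
  let b := - (x 0 iz - z0 * x 0 it) in
  inv_vec z0 f x = hvec (a * z0 + b) (a * z0 ^+ 2 + b * (2 * z0)) a.
Proof.
by apply: row3P; rewrite /inv_vec /line_vec !mxE /=; ring.
Qed.

Definition inv_mx z0 f : 'M[C]_3 := \matrix_(i < 3)
  (inv_vec z0 f (delta_mx 0 i) + hvec 0 ((delta_mx 0 i : 'rV_3) 0 iw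
   - 2 * z0 * (delta_mx 0 i : 'rV_3) 0 iz
   + z0 ^+ 2 * (delta_mx 0 i : 'rV_3) 0 it) 0).

Lemma mul_inv_mx z0 f x : x *m inv_mx z0 f =
  inv_vec z0 f x + hvec 0 (x 0 iw - 2 * z0 * x 0 iz + z0 ^+ 2 * x 0 it) 0.
Proof.
by apply: row3P; rewrite mxE sum3 !inv_vecE !mxE /=; rewrite ?inv_vecE ?mxE /=; ring.
Qed.

Lemma conic_involutive (g : C -> C) punct P : punctured_curve conic punct P ->
  proj_involution (tangent conic P) (conic_inv g P).
Proof.
case/andP; rewrite heval_conic subr_eq0 => /eqP e _.
have P0 := hcoord_neq0 P.
have [t0|t0] := eqVneq (hcoord P 0 it) 0.
  have z0 : hcoord P 0 iz = 0 by apply/eqP; rewrite -sqrf_eq0 -e t0 mulr0.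
  have w0 : hcoord P 0 iw != 0.
    by apply: contra_neq P0 => w0; apply: row3P; rewrite mxE.
  pose M : 'M[C]_3 := \matrix_(i < 3)
    nth 0 [:: hvec (-1) 0 0; hvec 0 1 0; hvec 0 0 1] i.
  have ME x : x *m M = hvec (- x 0 iz) (x 0 iw) (x 0 it).
    by apply: row3P; rewrite mxE sum3 !mxE /= ?mxE /=; ring.
  apply: (@proj_involution_mx _ _ _ M (hvec 0 0 1)^T (hvec 1 1 0)).
  - move=> Q; rewrite tangent_conic mulmx_hvecT t0 z0 !(mul0r, mulr0, add0r, mul1r).
    split=> [/eqP|->]; last by rewrite mulr0.
    by rewrite mulf_eq0 (negPf w0) => /eqP.
  - move=> Q; rewrite tangent_conic t0 z0 !(mul0r, mulr0, add0r).
    move/eqP; rewrite mulf_eq0 (negPf w0) /= => /eqP q0.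
    rewrite /conic_inv t0 eqxx /= /proj ME q0; congr mkpt.
    by apply: row3P; rewrite /swap_vec !inv_vecE !hvecE; ring.
  - apply/row_matrixP => i; rewrite !rowE mulmxA !ME mulmx1.
    by apply: row3P; rewrite !hvecE ?opprK.
  - by move=> x; rewrite !mulmx_hvecT ME !hvecE; rewrite !mul0r.
  - by rewrite mulmx_hvecT !hvecE; ring.
  - move=> c; rewrite ME !hvecE => h.
    have := congr1 (fun v : 'rV_3 => v 0 iw) h.
    have := congr1 (fun v : 'rV_3 => v 0 iz) h; rewrite mxE [X in _ -> X = _ -> _]hvecE.
    rewrite !mxE /= !mulr1 => <- /eqP; rewrite -subr_eq0 opprK -mulr2n.
    by rewrite pnatr_eq0.
set z0 := hcoord P 0 iz / hcoord P 0 it.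
have ez : hcoord P 0 iz = hcoord P 0 it * z0 by rewrite mulrC divfK.
have ew : hcoord P 0 iw = hcoord P 0 it * z0 ^+ 2.
  by apply: (mulIf t0); rewrite e ez; ring.
have tE Q : tangent conic P Q <->
    z0 ^+ 2 * hcoord Q 0 it + hcoord Q 0 iw - 2 * z0 * hcoord Q 0 iz = 0.
  rewrite tangent_conic ez ew; split=> [h|h].
    by apply: (mulfI t0); rewrite mulr0 -(subrr (2 * (hcoord P 0 it * z0) * hcoord Q 0 iz)) -{1}h; ring.
  apply/eqP; rewrite -subr_eq0; set d := _ - _.
  rewrite (_ : d = hcoord P 0 it * (z0 ^+ 2 * hcoord Q 0 it + hcoord Q 0 iw
    - 2 * z0 * hcoord Q 0 iz)); last by rewrite /d; ring.
  by rewrite h mulr0.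
pose x0 : 'rV[C]_3 := if g z0 == 0 then line_vec z0 1 1 else line_vec z0 0 1.
apply: (@proj_involution_mx _ _ _ (inv_mx z0 (g z0))
         (hvec (- 2 * z0) 1 (z0 ^+ 2))^T x0).
- move=> Q; rewrite tE mulmx_hvecT.
  by rewrite (_ : - 2 * z0 * _ + _ + _ = z0 ^+ 2 * hcoord Q 0 it + hcoord Q 0 iw - 2 * z0 * hcoord Q 0 iz) //; ring.
- move=> Q /tE h; rewrite /conic_inv t0 /proj mul_inv_mx -/z0.
  rewrite (_ : _ + z0 ^+ 2 * _ = 0); last by rewrite -h; ring.
  congr mkpt; rewrite (_ : hvec 0 0 0 = 0) ?addr0 //.
  by apply: row3P; rewrite !mxE.
- apply/row_matrixP => i; rewrite !rowE mulmxA !mul_inv_mx mulmx1.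
  set x := delta_mx _ _; clearbody x.
  by apply: row3P; rewrite !inv_vecE !mxE /=; ring.
- move=> x; rewrite !mulmx_hvecT mul_inv_mx inv_vecE !mxE /= => h.
  rewrite -[RHS]h; ring.
- rewrite mulmx_hvecT /x0 /line_vec; case: ifP => _; rewrite !mxE /=; ring.
- move=> c; rewrite mul_inv_mx => h.
  have hz := congr1 (fun v : 'rV_3 => v 0 iz) h.
  have ht := congr1 (fun v : 'rV_3 => v 0 it) h.
  move: hz ht; rewrite !inv_vecE /x0; case: eqVneq => [g0|g0].
    rewrite g0 !mxE /= => hz ht; have c1 : c = 1 by move: ht; rewrite !(mul0r,mulr0,mulr1,addr0).
    move: hz; rewrite c1 => /eqP; rewrite -subr_eq0.
    rewrite (_ : _ - _ = - 2%:R); last ring.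
    by rewrite oppr_eq0 pnatr_eq0.
  rewrite !mxE /= => _ /eqP; rewrite !(mul0r,mulr0,add0r,addr0,mulr1,subr0,mul1r).
  by apply/negP.
Qed.

Lemma conic_fix (g : C -> C) punct P : punctured_curve conic punct P ->
  conic_inv g P P = P.
Proof.
case/andP; rewrite heval_conic subr_eq0 => /eqP e _.
rewrite /conic_inv -[RHS]hcoordK; case: eqVneq => [t0|t0] /=; congr mkpt.
  have z0 : hcoord P 0 iz = 0 by apply/eqP; rewrite -sqrf_eq0 -e t0 mulr0.
  by apply: row3P; rewrite /swap_vec !inv_vecE !hvecE ?t0 ?z0; ring.
by apply: row3P; rewrite inv_vecE !hvecE; last first;
  [rewrite divfK // subrr; ring | apply: (mulIf t0); rewrite e; field | field].
Qed.

Definition conic_billiard (f : C -> C) (punct : seq (CP2 C)) : dual_billiard C :=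
  DualBilliard conic_homog (@conic_smooth punct)
    (@conic_involutive f punct) (@conic_fix f punct).

Lemma conic_inv_affine (f : C -> C) z0 u : 1 + f z0 * u != 0 ->
  conic_inv f (conic_pt z0) (mkpt (line_vec z0 1 u)) =
  mkpt (line_vec z0 1 (- (u / (1 + f z0 * u)))).
Proof.
move=> h.
have nz : hvec z0 (z0 ^+ 2) 1 != 0.
  by apply/eqP => /(congr1 (fun v : 'rV_3 => v 0 it)); rewrite !mxE /= => /eqP; rewrite oner_eq0.
have nz' : line_vec z0 1 u != 0.
  apply/eqP => /(congr1 (fun v : 'rV_3 => v 0 it)); rewrite !mxE /= mulr1 mulr0 addr0.
  by move/eqP; rewrite oner_eq0.
rewrite /conic_inv /conic_pt; have [c c0 ->] := hcoord_mkpt nz.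
have [d d0 ->] := hcoord_mkpt nz'.
rewrite !mxE /= mulr1 c0 mulrAC divff // mul1r.
rewrite -(@mkptZ _ (d * (1 + f z0 * u)) (line_vec _ _ _)) ?mulf_neq0 //; congr mkpt.
by apply: row3P; rewrite inv_vecE !mxE /=; field.
Qed.

Lemma swap_inv_vec s f a b : s != 0 ->
  let x := line_vec s^-1 a b in
  swap_vec (inv_vec s^-1 f x) = inv_vec s (4 / s - f / s ^+ 2) (swap_vec x).
Proof.
by move=> s0 x; apply: row3P; rewrite /x /swap_vec !inv_vecE !mxE /=; field.
Qed.

Definition fb1 z : C := (5 * z - 3) / (2 * z * (z - 1)).
Definition fb2 z : C := 3 * z / (z ^+ 2 + 1).
Definition fc1 z : C := 4 * z ^+ 2 / (z ^+ 3 - 1).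
Definition fc2 z : C := (8 * z - 4) / (3 * z * (z - 1)).

Lemma fc1_swap s : s != 0 -> s ^+ 3 != 1 ->
  4 / s - fc1 s^-1 / s ^+ 2 = 4 * s ^+ 2 / (s ^+ 3 - 1).
Proof.
move=> s0 s1; have h : s ^+ 3 - 1 != 0 by rewrite subr_eq0.
have h' : 1 - s ^+ 3 != 0 by rewrite subr_eq0 eq_sym.
rewrite /fc1 (_ : s^-1 ^+ 3 - 1 = (1 - s ^+ 3) / s ^+ 3); last by field.
by field; rewrite h h' s0.
Qed.

Definition omega : C := ('i * sqrtC 3 - 1) / 2.

Lemma omega_root : omega ^+ 2 + omega + 1 = 0.
Proof.
have i2 := sqrCi C; have s3 := sqrtCK (3 : C).
rewrite (_ : _ + 1 = ('i ^+ 2 * sqrtC 3 ^+ 2 + 3) / 4); last by rewrite /omega; field.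
by rewrite i2 s3 mulN1r addNr mul0r.
Qed.

(* The punctures are the points at which the family of involutions does not
   extend holomorphically: the poles of f and, except for [fc1], infinity. The
   poles of [fc1] are the cube roots of unity. *)
Definition billiard_b1 : dual_billiard C :=
  conic_billiard fb1 [:: conic_pt 0; conic_pt 1; conic_inf].
Definition billiard_b2 : dual_billiard C :=
  conic_billiard fb2 [:: conic_pt 'i; conic_pt (- 'i); conic_inf].
Definition billiard_c1 : dual_billiard C :=
  conic_billiard fc1 [:: conic_pt 1; conic_pt omega; conic_pt (omega ^+ 2)].
Definition billiard_c2 : dual_billiard C :=
  conic_billiard fc2 [:: conic_pt 0; conic_pt 1; conic_inf].

Definition Rb1 : field3 C := on_plane (fun z w : field3 C =>
  (w - z ^+ 2) ^+ 2 / ((w + 3 * z ^+ 2) * (z - 1) * (z - w))).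
Definition Rb2 : field3 C := on_plane (fun z w : field3 C =>
  (w - z ^+ 2) ^+ 2 / ((z ^+ 2 + w ^+ 2 + w + 1) * (z ^+ 2 + 1))).
Definition Rc1 : field3 C := on_plane (fun z w : field3 C =>
  (w - z ^+ 2) ^+ 3 / (1 + w ^+ 3 - 2 * z * w) ^+ 2).
Definition Rc2 : field3 C := on_plane (fun z w : field3 C =>
  (w - z ^+ 2) ^+ 3 / (8 * z ^+ 3 - 8 * z ^+ 2 * w - 8 * z ^+ 2 - w ^+ 2 - w
                       + 10 * z * w) ^+ 2).

End Conic.

Arguments billiard_b1 C : clear implicits.
Arguments billiard_b2 C : clear implicits.
Arguments billiard_c1 C : clear implicits.
Arguments billiard_c2 C : clear implicits.
Arguments Rb1 C : clear implicits.
Arguments Rb2 C : clear implicits.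
Arguments Rc1 C : clear implicits.
Arguments Rc2 C : clear implicits.

(* Main.v *)
Require Import Defs.
From mathcomp Require Import all_boot all_order all_algebra.
From mathcomp Require Import reals complex.
From mathcomp Require Import generic_quotient fraction mpoly ring.
Import GRing.Theory Num.Theory.
Local Open Scope ring_scope.

Set Implicit Arguments.
Unset Strict Implicit.

(* A Moebius map of the parameter z acts on the plane through its symmetric
   square, which preserves the conic, and it transforms f by an affine law under
   which f is determined by its poles and their residues. The residues are
   (3/2, 3/2, 1), for 2b1 at (0, infinity, 1) and for 2b2 at (i, -i, infinity),
   and (4/3, 4/3, 4/3), for 2c1 at the cube roots of unity and for 2c2 at
   (0, 1, infinity). Hence z |-> -i (z + 1) / (z - 1), respectively
   z |-> -omega (z - omega) / (z - 1), is an equivalence.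

   On the tangent line at (z, z^2), w - z^2 equals - b^2 in the homogeneous
   coordinates (a, b), so R is an integral because its denominator restricted to
   the line is invariant under (a, b) |-> (a + f b, - b). *)

(** * Fractions, homogeneous polynomials and linear substitutions *)

(** [pullback] is defined through the chosen representative of [f]; this identity is what ties that
    representative to [f]. *)
Lemma frac_numden (D : idomainType) (f : {fraction D}) :
  f = FracField.tofrac \n_(generic_quotient.repr f)
      / FracField.tofrac \d_(generic_quotient.repr f).
Proof.
have d0 := denom_ratioP (generic_quotient.repr f).
apply: canRL (mulfK _) _; first by rewrite tofrac_eq0.
rewrite -[X in X * _]reprK; unlock FracField.tofrac.
rewrite -[LHS]FracField.pi_mul; apply/eqmodP.
rewrite /= /FracField.equivf /FracField.mulf /=.
by rewrite !numden_Ratio ?mulf_neq0 ?oner_neq0 // !mulr1 mulrC.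
Qed.

Section ProjectivePlane.
Variable C : fieldType.
Implicit Types (p q N D : {mpoly C[3]}) (x v : 'rV[C]_3) (P Q : CP2 C).

Lemma meval_dhomogZ d c p (h : 'I_3 -> C) : p \is d.-homog ->
  p.@[fun i => c * h i] = c ^+ d * p.@[h].
Proof.
move=> /dhomogP hp; rewrite !mevalE mulr_sumr big_seq [RHS]big_seq.
apply: eq_bigr => m /hp hm; rewrite mulrCA; congr (_ * _).
under eq_bigr do rewrite exprMn.
by rewrite big_split /= prodrXr; congr (_ ^+ _ * _); rewrite -hm /= mdegE.
Qed.

Lemma heval_mkpt d p v : p \is d.-homog -> v != 0 ->
  exists2 c, c != 0 & heval p (mkpt v) = c * p.@[v 0].
Proof.
move=> hp v0; have [c c0 e] := hcoord_mkpt v0.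
exists (c ^+ d); first by rewrite expf_neq0.
rewrite /heval e -(meval_dhomogZ _ _ hp); apply: meval_eq => i; exact: mxE.
Qed.

(** The restriction of [p] to the parametrized line t |-> x + t v. Being given by [mmap], it is
    multiplicative, and the values are taken in a domain, where cancellation is possible. *)
Definition line_poly x v p : {poly C} :=
  mmap polyC (fun i => (x 0 i)%:P + (v 0 i)%:P * 'X) p.

Lemma line_polyM x v : {morph line_poly x v : p q / p * q}.
Proof. exact: rmorphM. Qed.

Lemma horner_line_poly x v p t : (line_poly x v p).[t] = p.@[(x + t *: v) 0].
Proof.
rewrite /line_poly /mmap horner_sum mevalE; apply: eq_bigr => m _.
rewrite hornerCM; congr (_ * _); rewrite /mmap1 horner_prod.
by apply: eq_bigr => i _; rewrite horner_exp !hornerE !mxE [t * _]mulrC.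
Qed.

Lemma is_repr_cross (f : field3 C) p q N D :
  is_repr f p q -> is_repr f N D -> p * D = q * N.
Proof.
case=> _ q0 -> [_ D0 e]; apply/eqP; rewrite -tofrac_eq !tofracM.
apply/eqP; rewrite [RHS]mulrC; apply/eqP.
by rewrite -eqr_div ?tofrac_eq0 // e.
Qed.

(** Row vectors keep the order of the factors: replacing v by v M in p (v M') gives p (v M M'). *)
Lemma lin_subst_mul (M M' : 'M[C]_3) p :
  lin_subst M (lin_subst M' p) = lin_subst (M *m M') p.
Proof.
elim/mpolyind: p => [|c m p _ _ ih]; first by rewrite /lin_subst !raddf0.
move: ih; rewrite /lin_subst !comp_mpolyD => ->; congr (_ + _).
rewrite !comp_mpolyZ; congr (_ *: _); rewrite !comp_mpolyX rmorph_prod.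
apply: eq_bigr => j _ /=; rewrite rmorphXn /= !tnth_mktuple; congr (_ ^+ _).
rewrite raddf_sum /=.
under eq_bigr => i _ do
  rewrite comp_mpolyZ comp_mpolyXU -tnth_nth tnth_mktuple scaler_sumr.
rewrite exchange_big /=; apply: eq_bigr => i _.
rewrite mxE scaler_suml; apply: eq_bigr => k _; by rewrite scalerA mulrC.
Qed.

Lemma lin_subst1 p : lin_subst 1%:M p = p.
Proof.
rewrite /lin_subst -[RHS]comp_mpoly_id; congr (_ \mPo _).
apply: eq_from_tnth => j; rewrite !tnth_mktuple (bigD1 j) //= big1 ?addr0.
  by rewrite mxE eqxx scale1r.
by move=> i /negPf ij; rewrite mxE ij scale0r.
Qed.

Lemma lin_substVK (A : 'M[C]_3) : A \in unitmx ->
  cancel (@lin_subst C A) (lin_subst (invmx A)).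
Proof. by move=> uA p; rewrite lin_subst_mul mulVmx // lin_subst1. Qed.

(** The hypothesis compares both functions in the source variables, so that [invmx A] never has to
    be computed. Substituting [invmx A] into it, and into the relation between N1 / D1 and its
    chosen representative, gives two identities from which the image of [D1] is cancelled. *)
Lemma pushforward_frac (A : 'M[C]_3) c N1 D1 N2 D2 :
    A \in unitmx -> D1 != 0 -> D2 != 0 ->
    N1 * lin_subst A D2 = c%:MP * lin_subst A N2 * D1 ->
  pushforward A (tofrac N1 / tofrac D1) = cst c * (tofrac N2 / tofrac D2).
Proof.
move=> uA D10 D20 e; rewrite /pushforward /pullback.
set f := (tofrac N1 / tofrac D1 : field3 C); have := frac_numden f.
set n := \n_ _; set d := \d_ _ => ef.
have uB : invmx A \in unitmx by rewrite unitmx_inv.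
have inj (M : 'M[C]_3) p : M \in unitmx -> p != 0 -> lin_subst M p != 0.
  move=> uM; apply: contra_neq => /(congr1 (lin_subst (invmx M))).
  by rewrite lin_substVK // /lin_subst raddf0.
have d0 : d != 0 by apply: denom_ratioP.
have e1 : N1 * d = n * D1.
  apply/eqP; rewrite -tofrac_eq !tofracM -eqr_div ?tofrac_eq0 //; apply/eqP; exact: ef.
have hM (M : 'M[C]_3) p q : lin_subst M (p * q) = lin_subst M p * lin_subst M q.
  exact: rmorphM.
have hC (M : 'M[C]_3) : lin_subst M c%:MP = c%:MP by exact: comp_mpolyC.
have := congr1 (lin_subst (invmx A)) e; rewrite !hM hC !lin_substVK // => e2.
have := congr1 (lin_subst (invmx A)) e1; rewrite !hM => e3.
rewrite /cst mulrA -tofracM; apply/eqP; rewrite eqr_div ?tofrac_eq0 ?inj //.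
rewrite -!tofracM tofrac_eq; apply/eqP.
apply: (mulIf (inj _ _ uB D10)).
by rewrite mulrAC -e3 mulrAC e2 mulrAC.
Qed.

End ProjectivePlane.

(** * Values of a rational function along a line *)

(** In characteristic zero the integers below the size of p - q are distinct, and they would be too
    many roots of a nonzero difference. *)
Lemma poly_eqP (F : numDomainType) (p q : {poly F}) :
  (forall t, p.[t] = q.[t]) -> p = q.
Proof.
move=> h; apply/eqP; rewrite -subr_eq0; apply: contraT => r0.
have := @max_poly_roots _ (p - q) [seq i%:R | i <- iota 0 (size (p - q))] r0.
rewrite size_map size_iota ltnn; apply.
  by apply/allP => _ /mapP [i _ ->]; rewrite rootE hornerD hornerN h subrr.
by rewrite map_inj_uniq ?iota_uniq // => i j /eqP; rewrite eqr_nat => /eqP.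
Qed.

(* The representatives p / q and p' / q' of N / D need not be its reduced form,
   and D may vanish at x or x'. The identity is proved between polynomials on
   the line, where a factor N D is cancelled. *)
Lemma value_along_line (F : numFieldType) (N D p q p' q' : {mpoly F[3]})
    (x v x' v' : 'rV[F]_3) t0 :
    (forall t, N.@[(x + t *: v) 0] = N.@[(x' + t *: v') 0]) ->
    (forall t, D.@[(x + t *: v) 0] = D.@[(x' + t *: v') 0]) ->
    N.@[(x + t0 *: v) 0] != 0 ->
    p * D = q * N -> p' * D = q' * N -> q.@[x 0] != 0 ->
  p.@[x 0] * q'.@[x' 0] = p'.@[x' 0] * q.@[x 0].
Proof.
move=> hN hD N0 e e' q0.
have at0 (r : {mpoly F[3]}) (y w : 'rV[F]_3) : r.@[y 0] = (line_poly y w r).[0].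
  by rewrite horner_line_poly scale0r addr0.
have line_eq (r : {mpoly F[3]}) :
    (forall t, r.@[(x + t *: v) 0] = r.@[(x' + t *: v') 0]) ->
    line_poly x v r = line_poly x' v' r.
  by move=> h; apply: poly_eqP => t; rewrite !horner_line_poly.
have NL0 : line_poly x v N != 0.
  by apply: contraNneq N0 => N0; rewrite -horner_line_poly N0 horner0.
have qL0 : line_poly x v q != 0.
  by apply: contraNneq q0 => qL0; rewrite (at0 _ _ v) qL0 horner0.
have := congr1 (line_poly x v) e; rewrite !line_polyM => eL.
have := congr1 (line_poly x' v') e'.
rewrite !line_polyM -(line_eq D) // -(line_eq N) // => eL'.
(* On the line p D = q N, and the right-hand side is not identically zero. *)
have DL0 : line_poly x v D != 0.
  by apply: contraNneq (mulf_neq0 qL0 NL0) => D0; rewrite -eL D0 mulr0.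
rewrite (at0 p _ v) (at0 q _ v) (at0 p' _ v') (at0 q' _ v') -!hornerM.
congr (_.[0]); apply: (mulIf (mulf_neq0 DL0 NL0)).
by rewrite mulrACA eL -eL' mulrC mulrACA.
Qed.

(** Numerator and denominator have the same degree, so the factor between [x] and the chosen
    coordinates of its point cancels. *)
Lemma has_value_mkpt (F : fieldType) (f : field3 F) (x : 'rV[F]_3) y :
    x != 0 -> has_value f (mkpt x) y ->
  exists p q, [/\ is_repr f p q, q.@[x 0] != 0 & y = p.@[x 0] / q.@[x 0]].
Proof.
move=> x0 [p [q [r q0 ->]]]; exists p, q; have [[d hp hq] _ _] := r.
have [c c0 e] := hcoord_mkpt x0.
have E (g : {mpoly F[3]}) : g \is d.-homog ->
    heval g (mkpt x) = c ^+ d * g.@[x 0].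
  move=> hg; rewrite /heval e -(meval_dhomogZ _ _ hg).
  by apply: meval_eq => i; exact: mxE.
move: q0; rewrite !E // mulf_eq0 negb_or => /andP [cd0 q0]; split=> //.
by rewrite -mulf_div divff // mul1r.
Qed.

(** Meant for [x'] and [v'] the images of [x] and [v] under a linear lift of the involution. One
    point of the line with N nonzero is enough, and it need not be [x]. *)
Lemma value_mkpt_line (F : numFieldType) (f : field3 F) N D (x v x' v' : 'rV[F]_3)
    t0 y y' :
    is_repr f N D -> has_value f (mkpt x) y -> has_value f (mkpt x') y' ->
    x != 0 -> x' != 0 ->
    (forall t, N.@[(x + t *: v) 0] = N.@[(x' + t *: v') 0]) ->
    (forall t, D.@[(x + t *: v) 0] = D.@[(x' + t *: v') 0]) ->
    N.@[(x + t0 *: v) 0] != 0 ->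
  y = y'.
Proof.
move=> rf + + x0 x'0 hN hD Nt0.
case/(has_value_mkpt x0) => p [q [r q0 ->]].
case/(has_value_mkpt x'0) => p' [q' [r' q0' ->]].
apply/eqP; rewrite eqr_div //; apply/eqP.
exact: (value_along_line hN hD Nt0 (is_repr_cross r rf) (is_repr_cross r' rf)).
Qed.

(** * Points and tangent lines of the conic, and a criterion for integrals *)

Section Conic.
Variable C : numClosedFieldType.
Implicit Types (z a b : C) (f : C -> C) (P Q : CP2 C) (s : seq (CP2 C)).
Implicit Types (N D : {mpoly C[3]}).

Lemma hvec_pt_neq0 z : hvec z (z ^+ 2) 1 != 0.
Proof.
apply/eqP => /(congr1 (fun v : 'rV_3 => v 0 it)); rewrite !mxE /=.
exact/eqP/oner_neq0.
Qed.

Lemma hvec_inf_neq0 : hvec 0 1 0 != 0 :> 'rV[C]_3.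
Proof.
apply/eqP => /(congr1 (fun v : 'rV_3 => v 0 iw)); rewrite !mxE /=.
exact/eqP/oner_neq0.
Qed.

Lemma hvec_eta (x : 'rV[C]_3) : x = hvec (x 0 iz) (x 0 iw) (x 0 it).
Proof. by apply: row3P; rewrite hvecE. Qed.

Lemma conic_ptP P : heval (conic C) P = 0 ->
  P = conic_inf C \/ exists z, P = conic_pt z.
Proof.
rewrite heval_conic => /eqP; rewrite subr_eq0 => /eqP e.
rewrite -[P]hcoordK; have := hcoord_neq0 P; move: (hcoord P) e => x e x0.
have [t0|t0] := eqVneq (x 0 it) 0; [left|right].
  have z0 : x 0 iz = 0 by apply/eqP; rewrite -sqrf_eq0 -e t0 mulr0.
  have w0 : x 0 iw != 0.
    by apply: contra_neq x0 => w0; apply: row3P; rewrite mxE.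
  rewrite /conic_inf -(mkptZ (hvec 0 1 0) w0); congr mkpt.
  by apply: row3P; rewrite mxE !hvecE ?mulr0 ?mulr1.
exists (x 0 iz / x 0 it); rewrite /conic_pt -[RHS](mkptZ _ t0); congr mkpt.
apply: row3P; rewrite mxE !hvecE.
- by rewrite mulrC divfK.
- by apply: (mulIf t0); rewrite e; field.
- by rewrite mulr1.
Qed.

Lemma tangent_ptP z Q : tangent (conic C) (conic_pt z) Q ->
  exists a b, hcoord Q = line_vec z a b.
Proof.
rewrite tangent_conic; have [c c0 ->] := hcoord_mkpt (hvec_pt_neq0 z).
rewrite !mxE /= mulr1 => h.
exists (hcoord Q 0 it), (hcoord Q 0 iz - z * hcoord Q 0 it).
apply: row3P; rewrite !mxE /= ?mulr0 ?mulr1 ?addr0 //; first by ring.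
apply: (mulfI c0); have -> : c * hcoord Q 0 iw =
  (c * hcoord Q 0 iw + c * z ^+ 2 * hcoord Q 0 it) - c * z ^+ 2 * hcoord Q 0 it by ring.
by rewrite h; ring.
Qed.

Lemma tangent_infP Q : tangent (conic C) (conic_inf C) Q ->
  exists a b, hcoord Q = hvec a b 0.
Proof.
rewrite tangent_conic; have [c c0 ->] := hcoord_mkpt hvec_inf_neq0.
rewrite !mxE /= !mulr0 !mul0r add0r mulr1 => /eqP.
rewrite mulf_eq0 (negPf c0) /= => /eqP h.
by exists (hcoord Q 0 iz), (hcoord Q 0 iw); rewrite {1}[hcoord Q]hvec_eta h.
Qed.

Lemma inv_line_vec z c a b :
  inv_vec z c (line_vec z a b) = line_vec z (a + c * b) (- b).
Proof.
rewrite /inv_vec; congr line_vec; rewrite !mxE /=; ring.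
Qed.

Lemma conic_inv_pt f z Q :
  conic_inv f (conic_pt z) Q = mkpt (inv_vec z (f z) (hcoord Q)).
Proof.
rewrite /conic_inv; have [c c0 ->] := hcoord_mkpt (hvec_pt_neq0 z).
by rewrite !mxE /= mulr1 c0 mulrAC divff // mul1r.
Qed.

Lemma conic_inv_inf f Q a b : hcoord Q = hvec a b 0 ->
  conic_inv f (conic_inf C) Q = mkpt (hvec (- a) b 0).
Proof.
move=> hQ; rewrite /conic_inv; have [c c0 ->] := hcoord_mkpt hvec_inf_neq0.
rewrite hQ !mxE /= mulr0 eqxx /=; congr mkpt.
by apply: row3P; rewrite /swap_vec !inv_vecE !hvecE; ring.
Qed.

(** The linear map (a, b) |-> (a + c b, - b) is its own inverse. *)
Lemma line_vec_inv_neq0 z c a b :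
  line_vec z a b != 0 -> line_vec z (a + c * b) (- b) != 0.
Proof.
apply: contra_neq => e; have := congr1 (inv_vec z c) e.
rewrite inv_line_vec mulrN opprK addrK => ->.
by apply: row3P; rewrite inv_vecE !mxE /=; ring.
Qed.

Lemma hvec_oppr_neq0 a b : hvec a b 0 != 0 -> hvec (- a) b 0 != 0.
Proof.
apply: contra_neq => /rowP e; apply: row3P; last by rewrite !mxE.
- by have := e iz; rewrite !mxE /= => /eqP; rewrite oppr_eq0 => /eqP.
- by have := e iw; rewrite !mxE.
Qed.

Lemma meval_conic (x : 'rV[C]_3) : (conic C).@[x 0] = x 0 iw * x 0 it - x 0 iz ^+ 2.
Proof. by rewrite mevalB expr2 !mevalM !mevalXU. Qed.

(** The numerator restricts to (- b^2)^n on a tangent line and is invariant, so only [D] has to be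
    tested. A conic point with D nonzero makes R non-constant, since R vanishes there without being
    zero. *)
Lemma conic_billiard_integral f s n D (R : field3 C) :
    (0 < n)%N -> D \is (2 * n).-homog ->
    R = tofrac (conic C ^+ n) / tofrac D ->
    (exists z, D.@[hvec z (z ^+ 2) 1 0] != 0) ->
    (forall z a b, conic_pt z \notin s ->
      D.@[line_vec z a b 0] = D.@[line_vec z (a + f z * b) (- b) 0]) ->
    (conic_inf C \notin s -> forall a b,
      D.@[hvec a b 0 0] = D.@[hvec (- a) b 0 0]) ->
  rational_integral (conic_billiard f s) R.
Proof.
move=> n0 hD RE [z0 Dz0] Dpt Dinf.
have D0 : D != 0 by apply: contraNneq Dz0 => ->; rewrite meval0.
have hN : conic C ^+ n \is (2 * n).-homog by apply: dhomogMn; exact: conic_homog.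
have repR : is_repr R (conic C ^+ n) D by split=> //; exists (2 * n)%N.
have NE (x : 'rV[C]_3) : (conic C ^+ n).@[x 0] = (x 0 iw * x 0 it - x 0 iz ^+ 2) ^+ n.
  by rewrite rmorphXn /= meval_conic.
split; first by exists (conic C ^+ n), D.
  move=> c; rewrite RE /cst => e.
  have {}e : conic C ^+ n = c%:MP * D.
    by apply/eqP; rewrite -tofrac_eq tofracM -e divfK // tofrac_eq0.
  (* At this point of the conic the numerator vanishes and D does not, so c = 0. The point (0, 1, 1)
     off the conic then gives a contradiction. *)
  have := congr1 (fun p => p.@[hvec z0 (z0 ^+ 2) 1 0]) e.
  rewrite /= mevalM mevalC NE !hvecE mulr1 subrr expr0n eqn0Ngt n0 /=.
  move/esym/eqP; rewrite mulf_eq0 (negPf Dz0) orbF => /eqP c0.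
  have := congr1 (fun p => p.@[hvec 0 1 1 0]) e.
  rewrite /= mevalM mevalC c0 mul0r NE !hvecE expr0n subr0 mulr1 expr1n.
  exact/eqP/oner_neq0.
move=> P Q y y' /andP [/eqP /conic_ptP hP Ps] tQ hy hy'.
have Q0 := hcoord_neq0 Q; rewrite -(hcoordK Q) in hy.
move: tQ hy'; case: hP Ps => [->|[z ->]] Ps tQ.
  have [a [b hQ]] := tangent_infP tQ; rewrite /= (conic_inv_inf _ hQ) => hy'.
  rewrite hQ in Q0 hy; have x0 := hvec_oppr_neq0 Q0.
  have shift t : (hvec a b 0 + t *: hvec 1 0 0 = hvec (a + t) b 0 :> 'rV[C]_3) *
      (hvec (- a) b 0 + t *: hvec (-1) 0 0 = hvec (- (a + t)) b 0 :> 'rV[C]_3).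
    by split; apply: row3P; rewrite !mxE /=; ring.
  (* The parameter 1 - a moves the first coordinate to 1, where the conic form - a^2 equals -1; [v']
     is the image of [v]. *)
  apply: (value_mkpt_line (v := hvec 1 0 0) (v' := hvec (-1) 0 0)
    (t0 := 1 - a) repR hy hy' Q0 x0).
  - by move=> t; rewrite !NE !shift !hvecE; congr (_ ^+ n); ring.
  - by move=> t; rewrite !shift; apply: Dinf.
  - rewrite NE shift !hvecE expf_neq0 //.
    by rewrite (_ : _ - _ = -1) ?oppr_eq0 ?oner_neq0 //; ring.
have [a [b hQ]] := tangent_ptP tQ.
rewrite /= conic_inv_pt hQ inv_line_vec => hy'.
rewrite hQ in Q0 hy; have x0 := line_vec_inv_neq0 (f z) Q0.
have shift t : (line_vec z a b + t *: line_vec z 0 1 = line_vec z a (b + t)) *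
    (line_vec z (a + f z * b) (- b) + t *: line_vec z (f z) (-1)
     = line_vec z (a + f z * (b + t)) (- (b + t))).
  by split; apply: row3P; rewrite !mxE /=; ring.
(* Likewise, 1 - b moves the second tangent coordinate to 1, away from the point of contact. *)
apply: (value_mkpt_line (v := line_vec z 0 1) (v' := line_vec z (f z) (-1))
  (t0 := 1 - b) repR hy hy' Q0 x0).
- by move=> t; rewrite !NE !shift !mxE /=; congr (_ ^+ n); ring.
- by move=> t; rewrite !shift; apply: Dpt.
- rewrite NE shift !mxE /= expf_neq0 //.
  by rewrite (_ : _ - _ = -1) ?oppr_eq0 ?oner_neq0 //; ring.
Qed.

End Conic.

(** * Projective transformations of the plane *)

Section Projective.
Variable F : fieldType.
Variable A : 'M[F]_3.
Hypothesis uA : A \in unitmx.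

Lemma mulmx_unit_neq0 (v : 'rV[F]_3) : v != 0 -> v *m A != 0.
Proof. by apply: contra_neq => e; rewrite -[v](mulmxK uA) e mul0mx. Qed.

Lemma proj_mkpt (v : 'rV[F]_3) : v != 0 -> proj A (mkpt v) = mkpt (v *m A).
Proof.
move=> v0; rewrite /proj; have [c c0 ->] := hcoord_mkpt v0.
by rewrite -scalemxAl mkptZ.
Qed.

Lemma proj_inj : injective (proj A).
Proof.
move=> P Q; rewrite /proj.
case/(mkpt_eq (mulmx_unit_neq0 (hcoord_neq0 P)) (mulmx_unit_neq0 (hcoord_neq0 Q))).
move=> c c0 e; rewrite -(hcoordK P) -(hcoordK Q) -[RHS](mkptZ _ c0); congr mkpt.
by rewrite -[LHS](mulmxK uA) e scalemxAl mulmxK.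
Qed.

End Projective.

(* The second symmetric power of z |-> (al z + be) / (ga z + de), acting on
   [z : w : t] through the parametrization [u v : u^2 : v^2] of the conic. *)
Definition moebius_mx (C : fieldType) (al be ga de : C) : 'M[C]_3 := \matrix_(i < 3)
  nth 0 [:: hvec (al * de + be * ga) (2 * al * be) (2 * ga * de);
            hvec (al * ga) (al ^+ 2) (ga ^+ 2);
            hvec (be * de) (be ^+ 2) (de ^+ 2)] i.

Lemma mul_moebius_mx (C : numClosedFieldType) (al be ga de : C) (x : 'rV[C]_3) :
  x *m moebius_mx al be ga de =
  hvec ((al * de + be * ga) * x 0 iz + al * ga * x 0 iw + be * de * x 0 it)
       (2 * al * be * x 0 iz + al ^+ 2 * x 0 iw + be ^+ 2 * x 0 it)
       (2 * ga * de * x 0 iz + ga ^+ 2 * x 0 iw + de ^+ 2 * x 0 it).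
Proof. by apply: row3P; rewrite mxE sum3 !mxE /= ?mxE /=; ring. Qed.

(** * Moebius maps as equivalences between billiards on the conic *)

Section MoebiusEquivalence.
Variable C : numClosedFieldType.
Variables al be ga de : C.
Let Delta := al * de - be * ga.
Hypothesis Delta0 : Delta != 0.
Implicit Types (z a b : C) (f : C -> C) (P Q : CP2 C) (s : seq (CP2 C)).
Local Notation A := (moebius_mx al be ga de).

(** The adjugate of the 2 x 2 matrix inverts it up to the scalar [Delta], which becomes [Delta ^+ 2]
    on symmetric squares. *)
Lemma moebius_mx_unit : A \in unitmx.
Proof.
have e : A *m (Delta ^- 2 *: moebius_mx de (- be) (- ga) al) = 1%:M.
  apply/row_matrixP => i; rewrite !rowE mulmxA mulmx1 -scalemxAr !mul_moebius_mx.
  set x := delta_mx _ _; clearbody x.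
  by apply: row3P; rewrite mxE !hvecE /Delta; field.
by case: (mulmx1_unit e).
Qed.

Lemma proj_moebius_pt z : ga * z + de != 0 ->
  proj A (conic_pt z) = conic_pt ((al * z + be) / (ga * z + de)).
Proof.
move=> k0; rewrite proj_mkpt ?hvec_pt_neq0 //.
rewrite /conic_pt -[RHS](mkptZ _ (expf_neq0 2 k0)); congr mkpt.
by rewrite mul_moebius_mx; apply: row3P; rewrite [RHS]mxE !hvecE; field.
Qed.

Lemma proj_moebius_pole z : ga * z + de = 0 -> proj A (conic_pt z) = conic_inf C.
Proof.
move=> k0; rewrite proj_mkpt ?hvec_pt_neq0 //.
have de_eq : de = - (ga * z) by apply/eqP; rewrite -addr_eq0 addrC k0.
have n0 : al * z + be != 0.
  apply: contraNneq Delta0 => e; rewrite /Delta de_eq.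
  have -> : be = - (al * z) by apply/eqP; rewrite -addr_eq0 addrC e.
  by apply/eqP; ring.
rewrite /conic_inf -[RHS](mkptZ _ (expf_neq0 2 n0)); congr mkpt.
by rewrite mul_moebius_mx de_eq; apply: row3P; rewrite [RHS]mxE !hvecE; ring.
Qed.

Lemma proj_moebius_inf : ga != 0 -> proj A (conic_inf C) = conic_pt (al / ga).
Proof.
move=> ga0; rewrite proj_mkpt ?hvec_inf_neq0 //.
rewrite /conic_pt -[RHS](mkptZ _ (expf_neq0 2 ga0)); congr mkpt.
by rewrite mul_moebius_mx; apply: row3P; rewrite [RHS]mxE !hvecE; field.
Qed.

(** The substitution multiplies the conic form by [Delta ^+ 2]. *)
Lemma conic_moebius P :
  (heval (conic C) (proj A P) == 0) = (heval (conic C) P == 0).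
Proof.
have v0 := mulmx_unit_neq0 moebius_mx_unit (hcoord_neq0 P).
have [c c0 ->] := heval_mkpt (conic_homog C) v0.
rewrite heval_conic meval_conic mul_moebius_mx !hvecE.
set x := hcoord P; rewrite (_ : _ * _ - _ =
  Delta ^+ 2 * (x 0 iw * x 0 it - x 0 iz ^+ 2)); last by rewrite /Delta; ring.
by rewrite mulf_eq0 (negPf c0) mulf_eq0 (negPf (expf_neq0 2 Delta0)).
Qed.

(* In the coordinates (a, b) of [line_vec], A acts between tangent lines by
   (a, b) |-> ((ga z + de)^2 a + 2 ga (ga z + de) b, Delta b). The relation
   between f1 and f2 says that this map conjugates (a, b) |-> (a + f1 b, - b)
   to (a, b) |-> (a + f2 b, - b). *)
Lemma conic_billiard_moebius f1 f2 s1 s2 :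
    map (proj A) s1 =i s2 ->
    (forall z, conic_pt z \notin s1 -> ga * z + de != 0 /\
      Delta * f2 ((al * z + be) / (ga * z + de)) =
      (ga * z + de) ^+ 2 * f1 z - 4 * ga * (ga * z + de)) ->
    (conic_inf C \notin s1 -> ga != 0 /\ Delta * f2 (al / ga) = 4 * ga * de) ->
  is_equivalence A (conic_billiard f1 s1) (conic_billiard f2 s2).
Proof.
move=> hs hpt hinf; split; first exact: moebius_mx_unit.
  move=> P; rewrite /db_curve /punctured_curve /= conic_moebius; congr (_ && ~~ _).
  by rewrite -hs mem_map //; exact: proj_inj moebius_mx_unit.
have uA := moebius_mx_unit.
move=> P Q /andP [/eqP /conic_ptP hP Ps] tQ.
have Q0 := hcoord_neq0 Q; have QA0 := mulmx_unit_neq0 uA Q0.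
have proj_inv z x f : x != 0 ->
    conic_inv f (conic_pt z) (mkpt x) = mkpt (inv_vec z (f z) x).
  move=> x0; rewrite conic_inv_pt; have [c c0 ->] := hcoord_mkpt x0.
  rewrite (_ : inv_vec _ _ _ = c *: inv_vec z (f z) x) ?mkptZ //.
  by apply: row3P; rewrite [RHS]mxE !inv_vecE !hvecE !mxE; ring.
have projQ : proj A Q = mkpt (hcoord Q *m A) by [].
move: tQ; case: hP Ps => [->|[z ->]] Ps tQ /=.
  (* This is the law for finite points written in s = 1/z, which exchanges [al] with [be] and [ga]
     with [de], changes the sign of [Delta], and gives the structure at s = 0 the value 0. *)
  have [ga0 e] := hinf Ps.
  have [a [b hQ]] := tangent_infP tQ; rewrite (conic_inv_inf _ hQ).
  rewrite hQ in Q0; have x0 := hvec_oppr_neq0 Q0.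
  rewrite proj_mkpt // proj_moebius_inf // projQ proj_inv //; congr mkpt.
  have -> : f2 (al / ga) = 4 * ga * de / Delta by rewrite -e [RHS]mulrC mulKf.
  rewrite hQ !mul_moebius_mx inv_vecE.
  by apply: row3P; rewrite !hvecE /Delta; field; rewrite ga0 Delta0.
have [k0 e] := hpt z Ps.
have [a [b hQ]] := tangent_ptP tQ; rewrite conic_inv_pt hQ inv_line_vec.
rewrite hQ in Q0; have x0 := line_vec_inv_neq0 (f1 z) Q0.
rewrite proj_mkpt // proj_moebius_pt // projQ proj_inv //; congr mkpt.
set z1 := _ / _; have -> : f2 z1 =
    ((ga * z + de) ^+ 2 * f1 z - 4 * ga * (ga * z + de)) / Delta.
  by rewrite -e [RHS]mulrC mulKf.
rewrite hQ !mul_moebius_mx inv_vecE /z1.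
by apply: row3P; rewrite !hvecE !mxE /= /Delta; field; rewrite k0 Delta0.
Qed.

End MoebiusEquivalence.

(** * Homogeneous forms of the numerators and denominators *)

Section Forms.
Variable R : comPzRingType.
Implicit Types z w t : R.

(** These forms are defined over any commutative ring because the same formula is used for
    polynomials, for fractions and for values; ring morphisms (evaluation, [tofrac], substitution)
    pass between them. *)
Definition conic_form z w t := w * t - z ^+ 2.
Definition den_b1 z w t := (w * t + 3 * z ^+ 2) * (z - t) * (z - w).
Definition den_b2 z w t := (z ^+ 2 + w ^+ 2 + w * t + t ^+ 2) * (z ^+ 2 + t ^+ 2).
Definition cubic_c1 z w t := t ^+ 3 + w ^+ 3 - 2 * (z * w * t).
Definition cubic_c2 z w t := 8 * z ^+ 3 - 8 * (z ^+ 2 * w) - 8 * (z ^+ 2 * t)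
  - w ^+ 2 * t - w * t ^+ 2 + 10 * (z * w * t).

End Forms.

Section FormMorphism.
Variables (R S : comPzRingType) (h : {rmorphism R -> S}).
Variables z w t : R.

Lemma rmorph_conic_form : h (conic_form z w t) = conic_form (h z) (h w) (h t).
Proof. rewrite /conic_form; ring. Qed.
Lemma rmorph_den_b1 : h (den_b1 z w t) = den_b1 (h z) (h w) (h t).
Proof. rewrite /den_b1; ring. Qed.
Lemma rmorph_den_b2 : h (den_b2 z w t) = den_b2 (h z) (h w) (h t).
Proof. rewrite /den_b2; ring. Qed.
Lemma rmorph_cubic_c1 : h (cubic_c1 z w t) = cubic_c1 (h z) (h w) (h t).
Proof. rewrite /cubic_c1; ring. Qed.
Lemma rmorph_cubic_c2 : h (cubic_c2 z w t) = cubic_c2 (h z) (h w) (h t).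
Proof. rewrite /cubic_c2; ring. Qed.

End FormMorphism.

Definition at_vars (C : fieldType)
    (g : {mpoly C[3]} -> {mpoly C[3]} -> {mpoly C[3]} -> {mpoly C[3]}) :=
  g 'X_iz 'X_iw 'X_it.

Section Homogeneity.
Variable C : fieldType.
Implicit Types p q : {mpoly C[3]}.

Lemma dhomog_var i : ('X_i : {mpoly C[3]}) \is 1.-homog.
Proof. by rewrite dhomogX; apply/eqP; exact: mdeg1. Qed.

Lemma dhomog_nat k : (k%:R : {mpoly C[3]}) \is 0.-homog.
Proof. by apply: rpredMn; exact: dhomog1. Qed.

Lemma dhomog_add d p q : p \is d.-homog -> q \is d.-homog -> p + q \is d.-homog.
Proof. exact: rpredD. Qed.

Lemma dhomog_opp d p : p \is d.-homog -> - p \is d.-homog.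
Proof. by rewrite rpredN. Qed.

Lemma dhomog_mul d e k p q :
  p \is d.-homog -> q \is e.-homog -> (d + e)%N = k -> p * q \is k.-homog.
Proof. by move=> hp hq <-; exact: dhomogM. Qed.

Lemma dhomog_exp d n k p : p \is d.-homog -> (d * n)%N = k -> p ^+ n \is k.-homog.
Proof. by move=> hp <-; exact: dhomogMn. Qed.

(** The degrees of subterms stay metavariables until the leaves fix them; [reflexivity] then
    computes or checks the degree of each product and power. *)
Ltac dhomog_form := lazymatch goal with
  | |- is_true (_ + _ \is _) => eapply dhomog_add; [dhomog_form | dhomog_form]
  | |- is_true (- _ \is _) => eapply dhomog_opp; dhomog_form
  | |- is_true (_ * _ \is _) =>
      eapply dhomog_mul; [dhomog_form | dhomog_form | reflexivity]
  | |- is_true (_ ^+ _ \is _) => eapply dhomog_exp; [dhomog_form | reflexivity]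
  | |- is_true (_%:R \is _) => apply: dhomog_nat
  | _ => apply: dhomog_var
  end.

Lemma homog_den_b1 : at_vars (@den_b1 {mpoly C[3]}) \is (2 * 2).-homog.
Proof. rewrite /at_vars /den_b1; dhomog_form. Qed.
Lemma homog_den_b2 : at_vars (@den_b2 {mpoly C[3]}) \is (2 * 2).-homog.
Proof. rewrite /at_vars /den_b2; dhomog_form. Qed.
Lemma homog_cubic_c1 : at_vars (@cubic_c1 {mpoly C[3]}) \is 3.-homog.
Proof. rewrite /at_vars /cubic_c1; dhomog_form. Qed.
Lemma homog_cubic_c2 : at_vars (@cubic_c2 {mpoly C[3]}) \is 3.-homog.
Proof. rewrite /at_vars /cubic_c2; dhomog_form. Qed.

End Homogeneity.

Section Dehomogenization.
Variable F : fieldType.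
Variables z w t : F.
Hypothesis t0 : t != 0.

(** Numerator and denominator both have degree 4 (degree 6 in the c cases), so the powers of t
    cancel. It is applied in the function field, to the images of the three variables. *)
Lemma dehomog_b1 : den_b1 z w t != 0 ->
  (w / t - (z / t) ^+ 2) ^+ 2
    / ((w / t + 3 * (z / t) ^+ 2) * (z / t - 1) * (z / t - w / t))
  = conic_form z w t ^+ 2 / den_b1 z w t.
Proof.
move=> d0; have -> : (w / t + 3 * (z / t) ^+ 2) * (z / t - 1) * (z / t - w / t)
  = den_b1 z w t / t ^+ 4 by rewrite /den_b1; field.
by rewrite /conic_form; field; rewrite d0 t0.
Qed.

Lemma dehomog_b2 : den_b2 z w t != 0 ->
  (w / t - (z / t) ^+ 2) ^+ 2
    / (((z / t) ^+ 2 + (w / t) ^+ 2 + w / t + 1) * ((z / t) ^+ 2 + 1))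
  = conic_form z w t ^+ 2 / den_b2 z w t.
Proof.
move=> d0; have -> : ((z / t) ^+ 2 + (w / t) ^+ 2 + w / t + 1) * ((z / t) ^+ 2 + 1)
  = den_b2 z w t / t ^+ 4 by rewrite /den_b2; field.
by rewrite /conic_form; field; rewrite d0 t0.
Qed.

Lemma dehomog_c1 : cubic_c1 z w t != 0 ->
  (w / t - (z / t) ^+ 2) ^+ 3 / (1 + (w / t) ^+ 3 - 2 * (z / t) * (w / t)) ^+ 2
  = conic_form z w t ^+ 3 / cubic_c1 z w t ^+ 2.
Proof.
move=> d0; have -> : 1 + (w / t) ^+ 3 - 2 * (z / t) * (w / t)
  = cubic_c1 z w t / t ^+ 3 by rewrite /cubic_c1; field.
by rewrite /conic_form; field; rewrite d0 t0.
Qed.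

Lemma dehomog_c2 : cubic_c2 z w t != 0 ->
  (w / t - (z / t) ^+ 2) ^+ 3
    / (8 * (z / t) ^+ 3 - 8 * (z / t) ^+ 2 * (w / t) - 8 * (z / t) ^+ 2
       - (w / t) ^+ 2 - w / t + 10 * (z / t) * (w / t)) ^+ 2
  = conic_form z w t ^+ 3 / cubic_c2 z w t ^+ 2.
Proof.
move=> d0; have -> : 8 * (z / t) ^+ 3 - 8 * (z / t) ^+ 2 * (w / t) - 8 * (z / t) ^+ 2
    - (w / t) ^+ 2 - w / t + 10 * (z / t) * (w / t)
  = cubic_c2 z w t / t ^+ 3 by rewrite /cubic_c2; field.
by rewrite /conic_form; field; rewrite d0 t0.
Qed.

End Dehomogenization.

(** * The four integrals *)

Lemma mem_seq3_last (T : eqType) (x y z : T) : z \in [:: x; y; z].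
Proof. by rewrite !inE eqxx !orbT. Qed.

Section Integrals.
Variable C : numClosedFieldType.
Local Notation M := {mpoly C[3]}.
Local Notation Db1 := (at_vars (@den_b1 M)).
Local Notation Db2 := (at_vars (@den_b2 M)).
Local Notation Gc1 := (at_vars (@cubic_c1 M)).
Local Notation Gc2 := (at_vars (@cubic_c2 M)).
Implicit Types (x : 'rV[C]_3) (z a b : C).

Lemma meval_den_b1 x : Db1.@[x 0] = den_b1 (x 0 iz) (x 0 iw) (x 0 it).
Proof. by rewrite /at_vars rmorph_den_b1 /= !mevalXU. Qed.
Lemma meval_den_b2 x : Db2.@[x 0] = den_b2 (x 0 iz) (x 0 iw) (x 0 it).
Proof. by rewrite /at_vars rmorph_den_b2 /= !mevalXU. Qed.
Lemma meval_cubic_c1 x : Gc1.@[x 0] = cubic_c1 (x 0 iz) (x 0 iw) (x 0 it).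
Proof. by rewrite /at_vars rmorph_cubic_c1 /= !mevalXU. Qed.
Lemma meval_cubic_c2 x : Gc2.@[x 0] = cubic_c2 (x 0 iz) (x 0 iw) (x 0 it).
Proof. by rewrite /at_vars rmorph_cubic_c2 /= !mevalXU. Qed.

(** At (z, z^2, 1) the four forms are - 4 z^3 (z - 1)^2, (z^2 + 1)^3, (z^3 - 1)^2 and - 9 z^2 (z -
    1)^2. They vanish only at punctures, whence the parameters 2, 0, 0 and 2. *)
Lemma den_b1_pt2 : Db1.@[hvec 2 (2 ^+ 2) 1 0] != 0.
Proof.
rewrite meval_den_b1 !hvecE (_ : den_b1 _ _ _ = - 32%:R).
  by rewrite oppr_eq0 pnatr_eq0.
by rewrite /den_b1; ring.
Qed.
Lemma den_b2_pt0 : Db2.@[hvec 0 (0 ^+ 2) 1 0] != 0.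
Proof.
rewrite meval_den_b2 !hvecE (_ : den_b2 _ _ _ = 1) ?oner_neq0 //.
by rewrite /den_b2; ring.
Qed.
Lemma cubic_c1_pt0 : Gc1.@[hvec 0 (0 ^+ 2) 1 0] != 0.
Proof.
rewrite meval_cubic_c1 !hvecE (_ : cubic_c1 _ _ _ = 1) ?oner_neq0 //.
by rewrite /cubic_c1; ring.
Qed.
Lemma cubic_c2_pt2 : Gc2.@[hvec 2 (2 ^+ 2) 1 0] != 0.
Proof.
rewrite meval_cubic_c2 !hvecE (_ : cubic_c2 _ _ _ = - 36%:R).
  by rewrite oppr_eq0 pnatr_eq0.
by rewrite /cubic_c2; ring.
Qed.

Lemma meval_neq0 (p : M) x : p.@[x 0] != 0 -> p != 0.
Proof. by apply: contraNneq => ->; rewrite meval0. Qed.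

Lemma tofrac_conic : FracField.tofrac (conic C) = conic_form
  (FracField.tofrac 'X_iz) (FracField.tofrac 'X_iw) (FracField.tofrac 'X_it).
Proof. by rewrite -rmorph_conic_form. Qed.

Lemma tofrac_it_neq0 : FracField.tofrac 'X_it != 0 :> field3 C.
Proof.
rewrite tofrac_eq0; apply: (@meval_neq0 _ (hvec 0 0 1)).
by rewrite mevalXU hvecE oner_neq0.
Qed.

Lemma Rb1E : Rb1 C = FracField.tofrac (conic C ^+ 2) / FracField.tofrac Db1.
Proof.
have := meval_neq0 den_b1_pt2; rewrite -tofrac_eq0 !tofracXn tofrac_conic.
by rewrite /at_vars rmorph_den_b1 /= => /(dehomog_b1 tofrac_it_neq0).
Qed.

Lemma Rb2E : Rb2 C = FracField.tofrac (conic C ^+ 2) / FracField.tofrac Db2.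
Proof.
have := meval_neq0 den_b2_pt0; rewrite -tofrac_eq0 !tofracXn tofrac_conic.
by rewrite /at_vars rmorph_den_b2 /= => /(dehomog_b2 tofrac_it_neq0).
Qed.

Lemma Rc1E : Rc1 C = FracField.tofrac (conic C ^+ 3) / FracField.tofrac (Gc1 ^+ 2).
Proof.
have := meval_neq0 cubic_c1_pt0; rewrite -tofrac_eq0 !tofracXn tofrac_conic.
by rewrite /at_vars rmorph_cubic_c1 /= => /(dehomog_c1 tofrac_it_neq0).
Qed.

Lemma Rc2E : Rc2 C = FracField.tofrac (conic C ^+ 3) / FracField.tofrac (Gc2 ^+ 2).
Proof.
have := meval_neq0 cubic_c2_pt2; rewrite -tofrac_eq0 !tofracXn tofrac_conic.
by rewrite /at_vars rmorph_cubic_c2 /= => /(dehomog_c2 tofrac_it_neq0).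
Qed.

Lemma billiard_b1_integral : rational_integral (billiard_b1 C) (Rb1 C).
Proof.
apply: (conic_billiard_integral (n := 2) _ (homog_den_b1 C) Rb1E) => //.
- by exists 2; exact: den_b1_pt2.
- move=> z a b; rewrite !inE !negb_or => /and3P [h0 h1 _].
  have z0 : z != 0 by apply: contraNneq h0 => ->.
  have z1 : z - 1 != 0 by rewrite subr_eq0; apply: contraNneq h1 => ->.
  rewrite !meval_den_b1 !mxE /= /den_b1 /fb1; field.
  by rewrite z0 z1.
- by rewrite mem_seq3_last.
Qed.

Lemma billiard_b2_integral : rational_integral (billiard_b2 C) (Rb2 C).
Proof.
apply: (conic_billiard_integral (n := 2) _ (homog_den_b2 C) Rb2E) => //.
- by exists 0; exact: den_b2_pt0.
- move=> z a b; rewrite !inE !negb_or => /and3P [h0 h1 _].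
  have z0 : z ^+ 2 + 1 != 0.
    rewrite -[1]opprK -(sqrCi C) subr_eq0 eqf_sqr negb_or.
    by apply/andP; split; [apply: contraNneq h0 => -> | apply: contraNneq h1 => ->].
  by rewrite !meval_den_b2 !mxE /= /den_b2 /fb2; field.
- by rewrite mem_seq3_last.
Qed.

Lemma omegaE : omega C ^+ 2 = - omega C - 1.
Proof. by apply/eqP; rewrite -subr_eq0 -(omega_root C); apply/eqP; ring. Qed.

Lemma billiard_c1_integral : rational_integral (billiard_c1 C) (Rc1 C).
Proof.
apply: (conic_billiard_integral (n := 3) _ (dhomogMn 2 (homog_cubic_c1 C)) Rc1E) => //.
- by exists 0; rewrite rmorphXn expf_neq0 //; exact: cubic_c1_pt0.
- move=> z a b; rewrite !inE !negb_or => /and3P [h0 h1 h2].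
  have z0 : z ^+ 3 - 1 != 0.
    have -> : z ^+ 3 - 1 = (z - 1) * (z - omega C) * (z - omega C ^+ 2).
      by ring: omegaE.
    rewrite !mulf_neq0 ?subr_eq0 //.
    + by apply: contraNneq h0 => ->.
    + by apply: contraNneq h1 => ->.
    + by apply: contraNneq h2 => ->.
  (* The cubic itself is invariant, not only its square. *)
  rewrite !rmorphXn /= !meval_cubic_c1; congr (_ ^+ 2).
  by rewrite !mxE /= /cubic_c1 /fc1; field.
(* Infinity is not a puncture here; on t = 0 the cubic reduces to w^3, which does not see the sign
   of a. *)
- move=> _ a b; rewrite !rmorphXn /= !meval_cubic_c1; congr (_ ^+ 2).
  by rewrite !mxE /= /cubic_c1; ring.
Qed.

Lemma billiard_c2_integral : rational_integral (billiard_c2 C) (Rc2 C).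
Proof.
apply: (conic_billiard_integral (n := 3) _ (dhomogMn 2 (homog_cubic_c2 C)) Rc2E) => //.
- by exists 2; rewrite rmorphXn expf_neq0 //; exact: cubic_c2_pt2.
- move=> z a b; rewrite !inE !negb_or => /and3P [h0 h1 _].
  have z0 : z != 0 by apply: contraNneq h0 => ->.
  have z1 : z - 1 != 0 by rewrite subr_eq0; apply: contraNneq h1 => ->.
  rewrite !rmorphXn /= !meval_cubic_c2; congr (_ ^+ 2).
  by rewrite !mxE /= /cubic_c2 /fc2; field; rewrite z0 z1.
- by rewrite mem_seq3_last.
Qed.

End Integrals.

(** * The two equivalences and their effect on the integrals *)

Lemma mem_seq3_swap (T : eqType) (x y z : T) : [:: x; y; z] =i [:: x; z; y].
Proof. by move=> u; rewrite !inE (orbC (u == y)). Qed.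

Section Equivalences.
Variable C : numClosedFieldType.
Local Notation M := {mpoly C[3]}.
Local Notation Db1 := (at_vars (@den_b1 M)).
Local Notation Db2 := (at_vars (@den_b2 M)).
Local Notation Gc1 := (at_vars (@cubic_c1 M)).
Local Notation Gc2 := (at_vars (@cubic_c2 M)).
Implicit Types z a b : C.

(** The four coefficients remain separate constants, so that [ring] can use the relations satisfied
    by 'i and omega. *)
Lemma lin_subst_moebius (al be ga de : C) :
  let S := lin_subst (moebius_mx al be ga de) in
  [/\ S 'X_iz = (al%:MP * de%:MP + be%:MP * ga%:MP) * 'X_iz + al%:MP * ga%:MP * 'X_iw
        + be%:MP * de%:MP * 'X_it,
      S 'X_iw = 2 * al%:MP * be%:MP * 'X_iz + al%:MP ^+ 2 * 'X_iw
        + be%:MP ^+ 2 * 'X_it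
    & S 'X_it = 2 * ga%:MP * de%:MP * 'X_iz + ga%:MP ^+ 2 * 'X_iw
        + de%:MP ^+ 2 * 'X_it].
Proof.
move=> S; rewrite /S /lin_subst !comp_mpolyXU -!tnth_nth !tnth_mktuple !sum3.
by rewrite !mxE /= -!mul_mpolyC; split; ring.
Qed.

(** Each map is fixed by the images of three punctures: [mx_b] sends 0, 1, infinity to i, infinity,
    -i, and [mx_c] sends 1, omega, omega^2 to infinity, 0, 1. *)
Definition mx_b : 'M[C]_3 := moebius_mx (- 'i) (- 'i) 1 (-1).
Definition mx_c : 'M[C]_3 := moebius_mx (- omega C) (omega C ^+ 2) 1 (-1).

Lemma det_b_neq0 : (- 'i) * -1 - (- 'i) * 1 != 0 :> C.
Proof.
by rewrite (_ : _ - _ = 2 * 'i) ?mulf_neq0 ?pnatr_eq0 ?neq0Ci //; ring.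
Qed.

Lemma det_c_neq0 : (- omega C) * -1 - omega C ^+ 2 * 1 != 0.
Proof.
(* [d] is omega - omega^2, a square root of -3. *)
set d := _ - _; have e : d ^+ 2 = - 3%:R by rewrite /d; ring: (omegaE C).
by rewrite -sqrf_eq0 e oppr_eq0 pnatr_eq0.
Qed.

Lemma billiard_b_equivalence : is_equivalence mx_b (billiard_b1 C) (billiard_b2 C).
Proof.
apply: (conic_billiard_moebius det_b_neq0).
- have e0 : proj mx_b (conic_pt 0) = conic_pt 'i.
    rewrite proj_moebius_pt; first by congr conic_pt; field.
    by rewrite mulr0 add0r oppr_eq0 oner_neq0.
  have e1 : proj mx_b (conic_pt 1) = conic_inf C.
    by apply: (proj_moebius_pole det_b_neq0); rewrite mulr1 subrr.
  have e2 : proj mx_b (conic_inf C) = conic_pt (- 'i).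
    by rewrite proj_moebius_inf ?oner_neq0 // divr1.
  by rewrite /= e0 e1 e2; exact: mem_seq3_swap.
- move=> z; rewrite !inE !negb_or => /and3P [h0 h1 _].
  have z0 : z != 0 by apply: contraNneq h0 => ->.
  have z1 : z - 1 != 0 by rewrite subr_eq0; apply: contraNneq h1 => ->.
  rewrite mul1r; split=> //; rewrite /fb2.
  (* The denominator of [fb2] at the image point. The factor 'i is isolated so that its square can
     be replaced by -1 before [field]. *)
  have -> : ((- 'i * z - 'i) / (z - 1)) ^+ 2 + 1 = - 4 * z / (z - 1) ^+ 2 :> C.
    rewrite (_ : _ / _ = - ('i * ((z + 1) / (z - 1)))); last by field.
    by rewrite sqrrN exprMn sqrCi; field.
  rewrite /fb1 (_ : - 'i * -1 - _ = 2 * 'i :> C); last by ring.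
  have -> : 2 * 'i * (3 * ((- 'i * z - 'i) / (z - 1)) / (- 4 * z / (z - 1) ^+ 2))
    = 'i ^+ 2 * (3 * (z + 1) * (z - 1) / (2 * z)) :> C by field; rewrite z0 z1.
  by rewrite sqrCi; field; rewrite z0 z1.
- by rewrite mem_seq3_last.
Qed.

Lemma billiard_c_equivalence : is_equivalence mx_c (billiard_c1 C) (billiard_c2 C).
Proof.
have om := omegaE C; have om3 : omega C ^+ 3 = 1 by ring: om.
have om1 : omega C - 1 != 0.
  apply: contraNneq det_c_neq0 => e; rewrite (_ : _ - _ = - omega C * (omega C - 1)).
    by rewrite e mulr0.
  by ring.
have omV : omega C ^+ 2 - 1 != 0.
  apply: contraNneq om1 => e.
  rewrite (_ : _ - 1 = - omega C * (omega C ^+ 2 - 1)); first by rewrite e mulr0.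
  by ring: om.
apply: (conic_billiard_moebius det_c_neq0).
- have e0 : proj mx_c (conic_pt 1) = conic_inf C.
    by apply: (proj_moebius_pole det_c_neq0); rewrite mulr1 subrr.
  have e1 : proj mx_c (conic_pt (omega C)) = conic_pt 0.
    rewrite proj_moebius_pt mul1r //.
    by congr conic_pt; rewrite (_ : _ + _ = 0) ?mul0r //; ring.
  have e2 : proj mx_c (conic_pt (omega C ^+ 2)) = conic_pt 1.
    rewrite proj_moebius_pt mul1r //.
    congr conic_pt; rewrite (_ : _ + _ = omega C ^+ 2 - 1) ?divff //.
    by ring: om.
  rewrite /= e0 e1 e2 => P; exact: (mem_rot 2 [:: conic_pt 0; conic_pt 1; conic_inf C]).
- move=> z; rewrite !inE !negb_or => /and3P [h0 h1 h2].
  have z1 : z - 1 != 0 by rewrite subr_eq0; apply: contraNneq h0 => ->.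
  have q0 : z ^+ 2 + z + 1 != 0.
    rewrite (_ : _ + 1 = (z - omega C) * (z - omega C ^+ 2)); last by ring: om.
    rewrite mulf_neq0 // subr_eq0.
      by apply: contraNneq h1 => ->.
    by apply: contraNneq h2 => ->.
  have c0 : z ^+ 3 - 1 != 0.
    by rewrite (_ : _ - 1 = (z - 1) * (z ^+ 2 + z + 1)) ?mulf_neq0 //; ring.
  rewrite mul1r; split=> //; rewrite /fc2 /fc1.
  set z2 := (_ + _) / (z - 1); rewrite -(mulrA 3 z2).
  (* The poles 0 and 1 of [fc2] pull back to omega and omega^2, the roots of z^2 + z + 1. *)
  have -> : z2 * (z2 - 1) = - (z ^+ 2 + z + 1) / (z - 1) ^+ 2.
    have -> : z2 - 1 = (omega C ^+ 2 * z - omega C) / (z - 1).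
      by rewrite /z2; field: om.
    by rewrite /z2 mulf_div -expr2; congr (_ / _); ring: om.
  rewrite /z2; field: om; by rewrite q0 z1 c0.
- move=> _; split; first exact: oner_neq0.
  (* Infinity is an ordinary point of the source billiard, and its image has the parameter -
     omega. *)
  rewrite divr1 /fc2 -mulrA (_ : - omega C * (- omega C - 1) = -1); last by ring: om.
  by field: om.
Qed.

(** The conic form is multiplied by (2 i)^2 = -4, hence its square by 16, and [den_b2] becomes 16
    times [den_b1]; this gives the constant 1. *)
Lemma pushforward_Rb : pushforward mx_b (Rb1 C) = cst 1 * Rb2 C.
Proof.
rewrite Rb1E Rb2E; apply: pushforward_frac.
- exact: moebius_mx_unit det_b_neq0.
- exact: meval_neq0 (den_b1_pt2 C).
- exact: meval_neq0 (den_b2_pt0 C).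
have [ez ew et] := lin_subst_moebius (- 'i : C) (- 'i) 1 (-1).
have i2 : 'i%:MP ^+ 2 = -1 :> M by rewrite -rmorphXn /= sqrCi rmorphN1.
rewrite mpolyC1 mul1r /lin_subst /at_vars rmorphXn /= rmorph_conic_form rmorph_den_b2 /=.
rewrite /mx_b -!/(lin_subst _ _) ez ew et !rmorphN !rmorph1 /=.
rewrite /den_b1 /den_b2 /conic_form /conic; ring: i2.
Qed.

(** The conic form is multiplied by -3 and [cubic_c2] becomes -9 times [cubic_c1], so the constant
    is 81 / (-27) = -3. *)
Lemma pushforward_Rc : pushforward mx_c (Rc1 C) = cst (- 3) * Rc2 C.
Proof.
rewrite Rc1E Rc2E; apply: pushforward_frac.
- exact: moebius_mx_unit det_c_neq0.
- by apply: expf_neq0; exact: meval_neq0 (cubic_c1_pt0 C).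
- by apply: expf_neq0; exact: meval_neq0 (cubic_c2_pt2 C).
have [ez ew et] := lin_subst_moebius (- omega C) (omega C ^+ 2) 1 (-1).
have om : (omega C)%:MP ^+ 2 = - (omega C)%:MP - 1 :> M.
  by rewrite -rmorphXn /= omegaE rmorphB rmorphN rmorph1.
rewrite /lin_subst /at_vars !rmorphXn /= rmorph_conic_form rmorph_cubic_c2 /=.
rewrite -!/(lin_subst _ _) ez ew et !rmorphXn !rmorphN !rmorph1 /=.
set z := 'X_iz; set w := 'X_iw; set t := 'X_it.
rewrite [cubic_c2 _ _ _](_ : _ = - 9 * cubic_c1 z w t); last first.
  by rewrite /cubic_c1 /cubic_c2; ring: om.
rewrite [conic_form _ _ _](_ : _ = - 3 * conic_form z w t); last first.
  by rewrite /conic_form; ring: om.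
by rewrite /conic_form /conic -/z -/w -/t rmorph_nat; ring.
Qed.

End Equivalences.

Theorem mainTheorem5 (R : realType) :
  let C : numClosedFieldType := R[i] in
  [/\ equivalent (billiard_b1 C) (billiard_b2 C)
    /\ equivalent (billiard_c1 C) (billiard_c2 C),
    [/\ rational_integral (billiard_b1 C) (Rb1 C),
        rational_integral (billiard_b2 C) (Rb2 C)
      & exists2 A : 'M[C]_3, is_equivalence A (billiard_b1 C) (billiard_b2 C)
        & exists2 c : C, c != 0 & pushforward A (Rb1 C) = cst c * Rb2 C]
  & [/\ rational_integral (billiard_c1 C) (Rc1 C),
        rational_integral (billiard_c2 C) (Rc2 C)
      & exists2 A : 'M[C]_3, is_equivalence A (billiard_c1 C) (billiard_c2 C)
        & exists2 c : C, c != 0 & pushforward A (Rc1 C) = cst c * Rc2 C]].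
Proof.
move=> C; have eb := billiard_b_equivalence C; have ec := billiard_c_equivalence C.
split.
- by split; [exists (mx_b C) | exists (mx_c C)].
- split; [exact: billiard_b1_integral | exact: billiard_b2_integral |].
  exists (mx_b C) => //; exists 1; first exact: oner_neq0.
  exact: pushforward_Rb.
- split; [exact: billiard_c1_integral | exact: billiard_c2_integral |].
  exists (mx_c C) => //; exists (- 3); first by rewrite oppr_eq0 pnatr_eq0.
  exact: pushforward_Rc.
Qed.
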